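(* Let $p(z)$ be a nonconstant complex polynomial, let $F(z)=|p(z)|^2=p(z)\overline{p(z)}$ for $z\in\mathbb{C}$, and let $z_0\in\mathbb{C}$ with $p(z_0)\neq 0$. If $p'(z_0)\neq 0$, then $-p(z_0)/p'(z_0)$ is a descent direction for $F$ at $z_0$.
   Context: A complex number $d$ is a descent direction for $F:\mathbb{C}\to\mathbb{R}$ at a point $z_0\in\mathbb{C}$ if there is a positive real number $\alpha_*$ such that $F(z_0+\alpha d)<F(z_0)$ for all $\alpha\in(0,\alpha_* )$. *)

(* Defs.v *)
From mathcomp Require Import all_boot all_order all_algebra.
From mathcomp Require Import reals.
From mathcomp Require Import complex.

Set Implicit Arguments.
Unset Strict Implicit.
Unset Printing Implicit Defensive.

Import Order.TTheory GRing.Theory Num.Theory.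
Local Open Scope ring_scope.
Local Open Scope complex_scope.

Definition descent_direction (R : realType) (F : R[i] -> R) (z0 d : R[i]) :
    Prop :=
  exists2 alpha_star : R, 0 < alpha_star &
    forall alpha : R, 0 < alpha -> alpha < alpha_star ->
      F (z0 + alpha%:C * d) < F z0.

(* The norm [`|z|] of R[i] is R[i]-valued; [Normc.normc] is the same modulus
   with values in R, so that the function below is genuinely real-valued. *)
Definition sq_modulus (R : realType) (p : {poly R[i]}) (z : R[i]) : R :=
  Normc.normc p.[z] ^+ 2.

Lemma sq_modulus_norm (R : realType) (p : {poly R[i]}) (z : R[i]) :
  (sq_modulus p z)%:C = `|p.[z]| ^+ 2.
Proof. by rewrite /sq_modulus rmorphXn. Qed.

Lemma sq_modulus_conj (R : realType) (p : {poly R[i]}) (z : R[i]) :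
  (sq_modulus p z)%:C = p.[z] * p.[z]^*.
Proof. by rewrite sq_modulus_norm sqr_normc. Qed.

(* Main.v *)
(** With [d = - p z0 / p' z0], Taylor expansion gives
    [p (z0 + a d) = (1 - a) p z0 + (a d)^2 q (a d)] for some polynomial [q].
    As [q] is bounded on the disk of radius [|d|], the decrease [a |p z0|] of
    the linear part dominates the quadratic remainder for small [a > 0]. *)
Require Import Defs.
From mathcomp Require Import all_boot all_order all_algebra.
From mathcomp Require Import reals.
From mathcomp Require Import complex.
From mathcomp Require Import ring.

Import Order.TTheory GRing.Theory Num.Theory.
Local Open Scope ring_scope.
Local Open Scope complex_scope.

Lemma horner_taylor2 (K : comNzRingType) (p : {poly K}) (z : K) :
  exists q : {poly K}, forall h : K,
    p.[z + h] = p.[z] + p^`().[z] * h + h ^+ 2 * q.[h].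
Proof.
elim/poly_ind: p => [|p c [q taylor_q]].
  by exists 0 => h; rewrite deriv0 !horner0; ring.
exists (q * (z%:P + 'X) + p^`().[z]%:P) => h.
by rewrite derivD derivM derivX derivC !hornerE taylor_q; ring.
Qed.

Lemma horner_newton_step_lt (K : numFieldType) (p : {poly K}) (z d : K) :
    p.[z] != 0 -> p^`().[z] * d = - p.[z] ->
  exists2 e : K, 0 < e &
    forall a : K, 0 < a -> a < e -> `|p.[z + a * d]| < `|p.[z]|.
Proof.
move=> pz_neq0 newton_d; have [q taylor_q] := horner_taylor2 K p z.
have [M q_le_M] := poly_disk_bound q `|d|.
have pz_gt0 : 0 < `|p.[z]| by rewrite normr_gt0.
have M_ge0 : 0 <= M := le_trans (normr_ge0 _) (q_le_M d (lexx _)).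
(* Both summands serve: [a * C < |p.[z]|] yields [a < 1] from the first and [a * |d| ^+ 2 * M <
   |p.[z]|] from the second. *)
pose C := `|p.[z]| + `|d| ^+ 2 * M.
have C_ge_pz : `|p.[z]| <= C by rewrite lerDl mulr_ge0 ?exprn_ge0.
have C_gt0 : 0 < C := lt_le_trans pz_gt0 C_ge_pz.
exists (`|p.[z]| / C) => [|a a_gt0]; first exact: divr_gt0.
rewrite ltr_pdivlMr // => aC_lt.
have a_lt1 : a < 1.
  by rewrite -(ltr_pM2r C_gt0) mul1r (lt_le_trans aC_lt).
have -> : p.[z + a * d] = (1 - a) * p.[z] + (a * d) ^+ 2 * q.[a * d].
  by rewrite taylor_q mulrCA newton_d; ring.
apply: le_lt_trans (ler_normD _ _) _.
rewrite 2!normrM normrX normrM (gtr0_norm a_gt0) gtr0_norm ?subr_gt0 //.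
have q_le : `|q.[a * d]| <= M.
  by apply: q_le_M; rewrite normrM gtr0_norm // ler_piMl // ltW.
rewrite mulrBl mul1r -addrA gtrDl addrC subr_lt0 exprMn [a ^+ 2]expr2.
rewrite -2!mulrA ltr_pM2l // (le_lt_trans _ aC_lt) // ler_pM2l //.
by rewrite (le_trans (ler_wpM2l _ q_le)) ?exprn_ge0 // lerDr ltW.
Qed.

Theorem corollary1 (R : realType) (p : {poly R[i]}) (z0 : R[i])
    (p_nonconstant : (1 < size p)%N)
    (pz0_neq0 : p.[z0] != 0)
    (dpz0_neq0 : p^`().[z0] != 0) :
  descent_direction (sq_modulus p) z0 (- p.[z0] / p^`().[z0]).
Proof.
have [|e e_gt0 decr] :=
    horner_newton_step_lt _ p z0 (- p.[z0] / p^`().[z0]) pz0_neq0.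
  by rewrite mulrC divfK.
(* In the partial order of [R[i]], [0 < e] forces [e] to be real, so its real part can serve as
   [alpha_star]. *)
have eE : e = (complex.Re e)%:C by rewrite RRe_real // gtr0_real.
exists (complex.Re e) => [|a a_gt0 a_lt]; first by rewrite -ltcR -eE.
rewrite -ltcR !sq_modulus_norm ltrXn2r ?normr_ge0 //.
by apply: decr; [rewrite (ltcR 0) | rewrite eE ltcR].
Qed.
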